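(* Let $B>1$ and $d>1$ be integers, and let $p$ be a prime not dividing $B$ such that $d$ divides $\operatorname{ord}(B,p)$. Then $p\in M_d(B)$, and moreover $p^h\in M_d(B)$ for every integer $h>0$.
   Context: For integers $B>1$, $N>1$ with $\gcd(N,B)=1$, let $e=\operatorname{ord}(B,N)$ (least $e>0$ with $B^e\equiv1\pmod N$). For a divisor $d$ of $e$ put $k=e/d$. For $x$ with $1\le x<N$, $\gcd(x,N)=1$, let $x/N=0.a_1a_2\ldots$ be its base-$B$ expansion (purely periodic with period $a_1\ldots a_e$), and let $S_d(x)=\sum_{j=1}^d\sum_{i=1}^k a_{(j-1)k+i}B^{k-i}$ be the sum of the $d$ integers represented in base $B$ by the $d$ consecutive blocks of length $k$ of the period. We say $N\in M_d(B)$ (the base-$B$ Midy property for the divisor $d$) if $d\mid e$ and $S_d(x)\equiv0\pmod{B^k-1}$ for every such $x$. *)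

(* Defs.v *)
From mathcomp Require Import all_boot all_order all_algebra.
From mathcomp Require Import cyclic.

Set Implicit Arguments.
Unset Strict Implicit.
Unset Printing Implicit Defensive.

Import Order.TTheory GRing.Theory Num.Theory.

Lemma ord_ex (B N : nat) :
  exists e, coprime B N ==> (0 < e) && (B ^ e == 1 %[mod N]).
Proof.
case: (boolP (coprime B N)) => [coBN | _]; last by exists 0.
case: (posnP N) => [N0 | N_gt0].
  by exists 1; move: coBN; rewrite N0 /coprime gcdn0 => /eqP ->.
by exists (totient N); rewrite totient_gt0 N_gt0 /=; apply/eqP/Euler_exp_totient.
Qed.

(* Only meaningful for coprime B and N; [ord B N] is 0 otherwise. *)
Definition ord (B N : nat) : nat := ex_minn (ord_ex B N).

(* For 0 <= r < 1, the digit a_i of r = 0.a_1 a_2 ... in base B; indices start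
   at 1. The lemmas [digit_lt] and [digit_expansion] show that this is the
   base-B expansion of r. *)
Definition digit (B : nat) (r : rat) (i : nat) : nat :=
  Num.truncn (B%:R ^+ i * r)%R %% B.

Lemma digit_lt (B : nat) (r : rat) (i : nat) : 0 < B -> digit B r i < B.
Proof. exact: ltn_pmod. Qed.

Lemma digit_expansion (B : nat) (r : rat) (n : nat) :
  1 < B -> (0 <= r < 1)%R ->
  (0 <= r - \sum_(1 <= i < n.+1) (digit B r i)%:R / B%:R ^+ i
     < (B%:R ^+ n)^-1)%R.
Proof.
move=> B_gt1 /andP[r_ge0 r_lt1].
have B_gt0 : (0 < B%:R :> rat)%R by rewrite ltr0n ltnW.
have Bn0 : (B%:R != 0 :> rat)%R by rewrite gt_eqF.
pose T i := Num.truncn (B%:R ^+ i * r)%R.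
have ge0 i : (0 <= B%:R ^+ i * r)%R by rewrite mulr_ge0 // exprn_ge0 // ltW.
have TS i : T i.+1 %/ B = T i.
  have /andP[lo hi] := truncn_itv (ge0 i).
  have /andP[lo' hi'] := truncn_itv (ge0 i.+1).
  apply/eqP; rewrite eqn_leq -ltnS ltn_divLR ?(ltnW B_gt1) //.
  rewrite leq_divRL ?(ltnW B_gt1) //.
  rewrite -(ltr_nat rat) natrM; apply/andP; split.
    apply: le_lt_trans lo' _.
    by rewrite exprS -mulrA mulrC ltr_pM2r.
  rewrite truncn_ge_nat ?ge0 // natrM exprS -mulrA mulrC.
  by rewrite ler_pM2l.
have ->: (\sum_(1 <= i < n.+1) (digit B r i)%:R / B%:R ^+ i
           = (T n)%:R / B%:R ^+ n :> rat)%R.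
  elim: n => [|n IHn].
    rewrite big_geq // expr0 divr1 (_ : T 0 = 0) //.
    by apply/truncn0Pn; rewrite expr0 mul1r -ltNge.
  rewrite big_nat_recr //= IHn [X in (_ = X%:R / _)%R](divn_eq (T n.+1) B) TS.
  rewrite natrD natrM mulrDl exprS; congr (_ + _)%R.
  by rewrite [(B%:R * _)%R]mulrC -mulf_div divff // mulr1.
have /andP[lo hi] := truncn_itv (ge0 n).
have Bp : (0 < B%:R ^+ n :> rat)%R by rewrite exprn_gt0.
rewrite subr_ge0 ler_pdivrMr // mulrC lo /=.
rewrite ltrBlDr -[X in (X + _)%R]mul1r -mulrDl ltr_pdivlMr //.
by rewrite [(r * _)%R]mulrC addrC natr1.
Qed.

Definition block_sum (d k B : nat) (r : rat) : nat :=
  \sum_(1 <= j < d.+1) \sum_(1 <= i < k.+1)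
    digit B r ((j - 1) * k + i) * B ^ (k - i).

(* N \in M_d(B), for B > 1, N > 1 and gcd(N, B) = 1. *)
Definition midy (d B N : nat) : Prop :=
  d %| ord B N /\
  forall x : nat, 1 <= x < N -> coprime x N ->
    let k := ord B N %/ d in
    block_sum d k B (x%:R / N%:R)%R = 0 %[mod B ^ k - 1].

(* Main.v *)
(* Let q i be the quotient and r i the remainder of B^i x by N. The block of
   length k starting after the digit m represents q (m + k) - B^k q m, so N
   times it is B^k r m - r (m + k). Summing over a whole period, N S_d(x) is
   (B^k - 1) times the sum R of the remainders r (jk), and R is congruent to
   x (B^e - 1) / (B^k - 1), which N divides as soon as B^k - 1 is coprime to N.
   If N = p^h and p divided B^k - 1, then p^h would divide
   B^(k p^(h-1)) - 1, so e = k d would divide k p^(h-1), and d would divide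
   p^(h-1); but d divides p - 1 and d > 1. *)

Require Import Defs.
From mathcomp Require Import all_boot all_order all_algebra.
From mathcomp Require cyclic.

Import Order.TTheory GRing.Theory Num.Theory.

Lemma ordP (B N : nat) : coprime B N ->
  [/\ 0 < ord B N, B ^ ord B N = 1 %[mod N] &
      forall m, 0 < m -> B ^ m = 1 %[mod N] -> ord B N <= m].
Proof.
move=> coBN; rewrite /ord; case: ex_minnP => e; rewrite coBN /=.
case/andP=> e_gt0 /eqP Be mine; split=> // m m_gt0 /eqP Bm.
by apply: mine; rewrite m_gt0.
Qed.

Lemma ord_dvdn (B N m : nat) :
  coprime B N -> B ^ m = 1 %[mod N] -> ord B N %| m.
Proof.
move=> coBN Bm; have [e_gt0 Be mine] := ordP _ _ coBN.
rewrite /dvdn; apply/contraT; rewrite -lt0n => r_gt0.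
have: ord B N <= m %% ord B N.
  apply: mine => //; move: Bm.
  have Bq : B ^ (m %/ ord B N * ord B N) = 1 %[mod N].
    by rewrite mulnC expnM -modnXm Be modnXm exp1n.
  by rewrite {1}(divn_eq m (ord B N)) expnD -modnMml Bq modnMml mul1n.
by rewrite leqNgt ltn_pmod.
Qed.

Lemma digit_divn (B N x i : nat) : 0 < N ->
  digit B (x%:R / N%:R)%R i = (B ^ i * x) %/ N %% B.
Proof.
move=> N_gt0; rewrite /digit; congr (_ %% _).
apply: truncn_def.
have N0 : (0 < N%:R :> rat)%R by rewrite ltr0n.
rewrite mulrA -natrX -natrM ler_pdivlMr // ltr_pdivrMr // -!natrM.
by rewrite ler_nat ltr_nat leq_divM ltn_ceil.
Qed.

(** Induction on [k]: appending a digit on the right multiplies the block by [B] and adds that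
    digit. The additive form avoids truncated subtraction. *)
Lemma block_divn (B N x m k : nat) : 0 < B -> 0 < N ->
  \sum_(1 <= i < k.+1) digit B (x%:R / N%:R)%R (m + i) * B ^ (k - i)
    + B ^ k * ((B ^ m * x) %/ N) = (B ^ (m + k) * x) %/ N.
Proof.
move=> B_gt0 N_gt0; elim: k => [|k IHk].
  by rewrite big_geq // mul1n addn0.
rewrite big_nat_recr //= subnn muln1 digit_divn // addnAC.
rewrite [RHS](divn_eq _ B); congr (_ + _).
have -> : (B ^ (m + k.+1) * x) %/ N %/ B = (B ^ (m + k) * x) %/ N.
  by rewrite -divnMA addnS expnSr mulnAC divnMr.
rewrite -IHk mulnDl expnSr mulnAC; congr (_ + _).
rewrite big_distrl; apply: eq_big_nat => i /andP[_ i_le] /=.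
by rewrite subSn // expnSr mulnA.
Qed.

Lemma block_modn (B N x m k : nat) : 0 < B -> 0 < N ->
  N * (\sum_(1 <= i < k.+1) digit B (x%:R / N%:R)%R (m + i) * B ^ (k - i))
    + (B ^ (m + k) * x) %% N = B ^ k * ((B ^ m * x) %% N).
Proof.
move=> B_gt0 N_gt0; apply/eqP.
rewrite -(eqn_add2l (N * (B ^ k * ((B ^ m * x) %/ N)))) addnA -mulnDr.
rewrite [X in N * X]addnC block_divn // [N * _]mulnC -divn_eq.
rewrite [N * _]mulnCA -mulnDr [N * _]mulnC -divn_eq.
by rewrite addnC expnD mulnA.
Qed.

Lemma block_sum_modn (B N x d k : nat) :
    0 < B -> 0 < N -> B ^ (d * k) = 1 %[mod N] ->
  N * block_sum d k B (x%:R / N%:R)%R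
    = (B ^ k - 1) * \sum_(j < d) (B ^ (j * k) * x) %% N.
Proof.
move=> B_gt0 N_gt0 Be; pose r j := (B ^ (j * k) * x) %% N.
(* The shift is cyclic: [r d = r 0] because [B ^ (d * k)] is 1 modulo [N]. *)
have shift : \sum_(j < d) r j.+1 = \sum_(j < d) r j.
  have rd : r d = r 0 by rewrite /r -modnMml Be modnMml.
  have := erefl (\sum_(j < d.+1) r j).
  by rewrite {1}big_ord_recl big_ord_recr /= rd addnC => /addIn.
(* Adding the sum of remainders to both sides removes the subtraction; shifted on the left, it
   matches [block_modn] term by term. *)
apply/eqP; rewrite -(eqn_add2r (\sum_(j < d) r j)) mulnBl mul1n subnK; last first.
  by rewrite leq_pmull // expn_gt0 B_gt0.
rewrite -{1}shift /block_sum big_add1 big_mkord !big_distrr -big_split.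
apply/eqP/eq_bigr => j _ /=.
by rewrite /r subn1 mulSnr block_modn.
Qed.

Lemma midy_coprime (B d N : nat) :
    0 < B -> 0 < N -> coprime B N -> d %| ord B N ->
  coprime N (B ^ (ord B N %/ d) - 1) -> midy d B N.
Proof.
move=> B_gt0 N_gt0 coBN d_dvd coN; split=> // x _ _ /=.
set k := ord B N %/ d in coN *.
have [_ Be _] := ordP _ _ coBN.
have dk : d * k = ord B N by rewrite mulnC divnK.
rewrite -dk in Be.
have NS := block_sum_modn B N x d k B_gt0 N_gt0 Be.
suff /dvdnP[c Rc] : N %| \sum_(j < d) (B ^ (j * k) * x) %% N.
  move/eqP: NS; rewrite Rc mulnA [_ * N]mulnC eqn_pmul2l // => /eqP->.
  by rewrite modnMr mod0n.
rewrite /dvdn modn_summ -big_distrl /= -/(dvdn _ _) dvdn_mulr //.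
(* The factor [B ^ k - 1], coprime to [N], turns the geometric sum into [B ^ (d * k) - 1]. *)
rewrite -(Gauss_dvdr _ coN).
rewrite (eq_bigr (fun j : 'I_d => (B ^ k) ^ j)) => [|j _]; last first.
  by rewrite mulnC expnM.
rewrite subn1 -predn_exp -expnM mulnC -subn1 -eqn_mod_dvd ?expn_gt0 ?B_gt0 //.
exact/eqP.
Qed.

(** Each further [p]-th power multiplies the predecessor by a geometric sum of [p] terms, all 1
    modulo [p], and so gains a factor [p]. *)
Lemma dvdn_pred_expX (p a h : nat) :
  0 < a -> p %| a.-1 -> p ^ h.+1 %| (a ^ (p ^ h)).-1.
Proof.
move=> a_gt0 p_dvd; elim: h => [|h IHh]; first by rewrite !expn1.
rewrite [in a ^ _]expnSr expnM predn_exp expnSr dvdn_mul //.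
have a1 : a = 1 %[mod p] by apply/eqP; rewrite eqn_mod_dvd // subn1.
rewrite /dvdn -modn_summ.
under eq_bigr => i _ do rewrite -expnM -modnXm a1 modnXm exp1n.
by rewrite modn_summ sum1_card card_ord modnn.
Qed.

Theorem theorem3 (B d p : nat) (hB : 1 < B) (hd : 1 < d) (hp : prime p)
    (hpB : ~~ (p %| B)) (hdord : d %| ord B p) :
  midy d B p /\ (forall h : nat, 0 < h -> midy d B (p ^ h)).
Proof.
suff midyX h : 0 < h -> midy d B (p ^ h).
  by split=> //; rewrite -[p]expn1; apply: midyX.
(* The exponent is now [h.+1], so the power p^(h-1) of the argument by contradiction becomes
   [p ^ h]. *)
case: h => // h _.
have B_gt0 := ltnW hB; have p_gt0 := prime_gt0 hp.
have coBp : coprime B p by rewrite coprime_sym prime_coprime.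
have coBN : coprime B (p ^ h.+1) by rewrite coprimeXr.
have [e_gt0 Be _] := ordP _ _ coBN.
(* A congruence modulo [p ^ h.+1] also holds modulo [p], so [ord B p] divides [ord B (p ^ h.+1)]. *)
have d_dvd : d %| ord B (p ^ h.+1).
  apply: dvdn_trans hdord _; apply: ord_dvdn => //.
  apply/eqP; rewrite eqn_mod_dvd ?expn_gt0 ?B_gt0 //.
  apply: (@dvdn_trans (p ^ h.+1)); first by rewrite expnS dvdn_mulr.
  by rewrite -eqn_mod_dvd ?expn_gt0 ?B_gt0 //; apply/eqP.
apply: midy_coprime => //; first by rewrite expn_gt0 p_gt0.
rewrite coprimeXl // prime_coprime //; apply/negP; rewrite subn1 => p_dvd.
have k_gt0 : 0 < ord B (p ^ h.+1) %/ d.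
  by rewrite divn_gt0 ?(ltnW hd) // dvdn_leq.
have: ord B (p ^ h.+1) %| (ord B (p ^ h.+1) %/ d) * p ^ h.
  apply: ord_dvdn => //; apply/eqP.
  rewrite eqn_mod_dvd ?expn_gt0 ?B_gt0 // subn1 expnM.
  by apply: dvdn_pred_expX; rewrite ?expn_gt0 ?B_gt0.
rewrite -{1}(divnK d_dvd) dvdn_pmul2l // => d_dvd_pX.
(* Fermat's little theorem bounds [ord B p], hence [d], in divisibility. *)
have d_dvd_p1 : d %| p.-1.
  apply: dvdn_trans hdord _; apply: ord_dvdn => //.
  by rewrite -totient_prime //; apply: cyclic.Euler_exp_totient.
have co_d_pX : coprime d (p ^ h).
  by apply: coprimeXr; apply: coprime_dvdl d_dvd_p1 _; rewrite coprimePn.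
have: d %| 1 by rewrite -(Gauss_dvdr _ co_d_pX) muln1.
by rewrite dvdn1 => /eqP d1; rewrite d1 in hd.
Qed.
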